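(* There exists a homogeneously multifractal (HM) measure $\mu$ on $[0,1]$ such that $\mathrm{Support}(d_\mu)=[0,1]\cup\{2\}$.
   Context: Measures are positive Borel measures; $\mathrm{Supp}(\mu)$ is the smallest closed set whose complement has $\mu$-measure $0$. For $x_0\in \mathrm{Supp}(\mu)$ the (lower) local dimension is $$h_\mu(x_0)=\liminf_{r\to0^+}\frac{\log\mu(B(x_0,r))}{\log r},$$ where $B(x_0,r)$ is the open ball with center $x_0$ and radius $r$; for $x_0\notin \mathrm{Supp}(\mu)$ one sets $h_\mu(x_0)=+\infty$. Let $\dim$ denote Hausdorff dimension with the convention $\dim\emptyset=-\infty$. The multifractal spectrum of a measure $\mu$ supported in $[0,1]$ is $d_\mu(h)=\dim\{x\in[0,1]:h_\mu(x)=h\}$ for $h\ge0$, and $\mathrm{Support}(d_\mu)=\{h\ge0: d_\mu(h)\ge0\}$. A measure $\mu$ supported in $[0,1]$ is homogeneously multifractal (HM) if for every non-degenerate subinterval $U\subset[0,1]$ and every $h\ge0$, $\dim\{x\in U:h_\mu(x)=h\}=\dim\{x\in[0,1]:h_\mu(x)=h\}=d_\mu(h)$. *)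

(* Defs.v *)
From HB Require Import structures.
From mathcomp Require Import all_boot all_order all_algebra.
From mathcomp Require Import all_classical all_reals all_analysis.
Set Implicit Arguments.
Unset Strict Implicit.
Unset Printing Implicit Defensive.
Import Order.TTheory GRing.Theory Num.Theory.
Import numFieldNormedType.Exports.
Local Open Scope classical_set_scope.
Local Open Scope ring_scope.
Local Open Scope ereal_scope.

Section hausdorff_dimension.
Context {R : realType}.
Implicit Types (A : set R) (s d : R).

(* The empty case is separate because [ereal_sup set0 = -oo]. *)
Definition diameter A : \bar R :=
  if A == set0 then 0
  else ereal_sup [set (`|p.1 - p.2|%R)%:E | p in A `*` A].

(* diam(A)^s, where the empty set weighs 0 even for s = 0; for s = 0 nonempty
   sets, singletons included, weigh 1. *)
Definition hausdorff_weight s A : \bar R :=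
  if A == set0 then 0 else diameter A `^ s.

Definition hausdorff_content s d A : \bar R :=
  ereal_inf [set \sum_(0 <= k <oo) hausdorff_weight s (B k) |
    B in [set B : nat -> set R |
      A `<=` \bigcup_k B k /\ forall k, diameter (B k) <= d%:E]].

Definition hausdorff_measure s A : \bar R :=
  ereal_sup [set hausdorff_content s d A | d in [set d | (0 < d)%R]].

Definition hausdorff_dim A : \bar R :=
  if A == set0 then -oo
  else ereal_inf [set s%:E | s in [set s | (0 <= s)%R /\
                                           hausdorff_measure s A = 0]].

End hausdorff_dimension.

Section multifractal.
Context {R : realType}.
Variable mu : {finite_measure set (measurableTypeR R) -> \bar R}.
Implicit Types (x h : R) (U : set R).

Definition measure_supp : set R :=
  \bigcap_(F in [set F : set R | closed F /\ mu (~` F) = 0]) F.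

(* [mu] is finite, so [fine] loses no information here. *)
Definition local_dim x : \bar R :=
  if x \in measure_supp then
    limf_einf (fun r : R => (ln (fine (mu (ball x r))) / ln r)%:E) 0%R^'+
  else +oo.

Definition local_dim_level h : set R := [set x | local_dim x = h%:E].

Definition multifractal_spectrum h : \bar R :=
  hausdorff_dim (`[0%R, 1%R] `&` local_dim_level h).

Definition spectrum_support : set R :=
  [set h | (0 <= h)%R /\ 0 <= multifractal_spectrum h].

Definition homogeneously_multifractal : Prop :=
  forall U, U `<=` `[0%R, 1%R] -> is_interval U ->
    (exists x y, [/\ U x, U y & (x < y)%R]) ->
  forall h, (0 <= h)%R ->
    hausdorff_dim (U `&` local_dim_level h) = multifractal_spectrum h.

End multifractal.

(* Main.v *)
From HB Require Import structures.
Require Import Defs.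
From mathcomp Require Import all_boot all_order all_algebra.
From mathcomp Require Import all_classical all_reals all_analysis.
From mathcomp Require Import measurable_realfun.
From mathcomp Require Import ring lra zify.
Set Implicit Arguments.
Unset Strict Implicit.
Unset Printing Implicit Defensive.
Import Order.TTheory GRing.Theory Num.Theory.
Import numFieldNormedType.Exports.
Local Open Scope classical_set_scope.
Local Open Scope ring_scope.

(** The measure is a sum of point masses. Let [den k = 3 ^ (k+2)!], let
    [grid k] be the multiples of [1 / den k] and [hole k] the midpoints between
    neighbours in [grid k]. As 3 is odd, both families increase with [k]. At depth
    [k.+2], every grid point [a] of the unit interval carries the mass
    [gap k a / den k.+2], where [gap k a] is the distance from [a] to [hole k];
    these layers are added with the weights [2 ^- k.+1]. The exponents
    [level k = (k+2)!] satisfy [level k / level k.+1 --> 0], so that a factor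
    [gap k a >= c / den k.+1] costs nothing in the exponent of [1 / den k.+2].

    Around a hole [p], an atom at distance [d] of any deep layer is lighter by a
    factor [d], so a ball of radius [r] has mass of order at most [r ^ 2]; and no
    grid point is so close to a hole that its weight is much below [den ^- 2].
    Hence the local dimension is 2 at holes ([local_dim_hole]). A point [x] that is
    not a hole cannot be in the immediate vicinity of holes at all scales
    ([gap_small_hole]): infinitely often [gap k x >= 1 / (4 * den k.+1)], and then
    the atom of depth [k.+2] next to [x] weighs [1 / den k.+2] up to a negligible
    exponent, at a distance of at most [1 / den k.+2]. Since the local dimension is
    a lower limit, these scales suffice to bound it by 1
    ([local_dim_not_hole_le]); this is why nothing lies strictly between 1 and 2.
    Atoms have local dimension 0, and [0 < h <= 1] is the local dimension of a point
    which at each depth is at distance about [(1 / den k) `^ h^-1] from the grid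
    ([local_dim_prescribed]).

    Homogeneity needs no dimension to be computed. A translation by a triadic
    number preserves every fine layer, and the coarse layers have no atom near a
    point which is not itself triadic, so the local dimension is invariant
    ([local_dim_translate]). The part of a level set in the unit interval is thus
    covered by finitely many translates of its part in any triadic subinterval,
    and a finite union of translates of [A] has no larger Hausdorff dimension than
    [A] ([hausdorff_dim_translates]). *)

(** * Lower limits at 0 and the local dimension *)

Section lower_limit.
Context {R : realType}.
Implicit Types (f g : R -> \bar R) (s : R).

Lemma at_right0_itv (d : R) : 0 < d -> (0^'+)%R [set r : R | 0 < r < d].
Proof.
move=> d0; suff : \forall r \near (0 : R)^'+, 0 < r < d by [].
by near=> r; apply/andP; split; near: r;
  [exact: nbhs_right_gt|exact: nbhs_right_lt].
Unshelve. all: by end_near. Qed.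

Lemma at_right0P (V : set R) : (0^'+)%R V ->
  exists2 d : R, 0 < d & [set r : R | 0 < r < d] `<=` V.
Proof.
move=> /nbhs_ballP[e /= e0 eV]; exists e => // r /= /andP[r0 re].
by apply: eV => //; rewrite /ball /= sub0r normrN gtr0_norm.
Qed.

Lemma limf_einf_ge f s :
  (forall e, 0 < e -> exists2 d, 0 < d &
    forall r, 0 < r < d -> ((s - e)%:E <= f r)%E) ->
  (s%:E <= limf_einf f (0^'+)%R)%E.
Proof.
move=> H; apply/lee_subgt0Pr => e e0; have [d d0 Hd] := H _ e0.
rewrite limf_einfE; apply: le_ereal_sup_tmp.
exists (ereal_inf (f @` [set r : R | 0 < r < d])).
  by exists [set r : R | 0 < r < d] => //; exact: at_right0_itv.
by apply: le_ereal_inf_tmp => _ [r /= rd <-]; rewrite -EFinB; exact: Hd.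
Qed.

Lemma limf_einf_le f s :
  (forall e d, 0 < e -> 0 < d -> exists2 r, 0 < r < d & (f r <= (s + e)%:E)%E) ->
  (limf_einf f (0^'+)%R <= s%:E)%E.
Proof.
move=> H; apply/lee_addgt0Pr => e e0; rewrite limf_einfE.
apply: ge_ereal_sup => _ [V /at_right0P[d d0 dV] <-].
have [r rd fr] := H _ _ e0 d0.
apply: ge_ereal_inf; exists (f r); last by rewrite -EFinD.
by exists r => //; exact: dV.
Qed.

Lemma limf_einf_near f g (d : R) : 0 < d ->
  (forall r, 0 < r < d -> f r = g r) ->
  limf_einf f (0^'+)%R = limf_einf g (0^'+)%R.
Proof.
move=> d0; suff le_f_g f1 f2 : (forall r, 0 < r < d -> f1 r = f2 r) ->
    (limf_einf f1 (0^'+)%R <= limf_einf f2 (0^'+)%R)%E.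
  by move=> fg; apply/eqP; rewrite eq_le !le_f_g// => r rd; rewrite fg.
move=> fg; rewrite !limf_einfE.
apply: ge_ereal_sup => _ [V FV <-].
apply: le_ereal_sup_tmp.
exists (ereal_inf (f2 @` (V `&` [set r : R | 0 < r < d]))).
  exists (V `&` [set r : R | 0 < r < d]) => //.
  by apply: filterI => //; exact: at_right0_itv.
apply: le_ereal_inf_tmp => _ [r [Vr rd] <-].
by apply: ereal_inf_lbound; exists r => //; exact: fg.
Qed.

End lower_limit.

Section local_dimension.
Context {R : realType} (mu : {finite_measure set (measurableTypeR R) -> \bar R}).
Implicit Types (x s : R).

Definition ball_mass x (r : R) : R := fine (mu (ball x r)).

(** Ball masses must be positive because [ln 0] is [0] by convention. *)
Lemma local_dim_ge x s (C : R) : measure_supp mu x ->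
  (forall r, 0 < r -> 0 < ball_mass x r) -> 0 < C ->
  (exists2 d, 0 < d & forall r, 0 < r < d -> ball_mass x r <= C * r `^ s) ->
  (s%:E <= local_dim mu x)%E.
Proof.
move=> xsupp m_gt0 C0 [d d0 Hd].
rewrite /local_dim mem_set//; apply: limf_einf_ge => e e0.
(* Below [d'] the constant [C] is absorbed in [r `^ - e]. *)
pose d' := expR (- (`|ln C| / e) - 1).
have d'0 : 0 < d' by exact: expR_gt0.
have d'1 : d' < 1.
  rewrite /d' -[X in _ < X]expR0 ltr_expR.
  by have : 0 <= `|ln C| / e; [rewrite divr_ge0// ltW|lra].
exists (Num.min d d'); first by rewrite lt_min d0.
move=> r /andP[r0]; rewrite lt_min => /andP[rd rd'].
have rpos : r \is Num.pos by rewrite posrE.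
have lr : ln r < - (`|ln C| / e).
  have : ln r < ln d' by rewrite ltr_ln.
  by rewrite /d' expRK; lra.
have lr0 : ln r < 0.
  by have : 0 <= `|ln C| / e; [rewrite divr_ge0// ltW|lra].
rewrite lee_fin ler_ndivlMr// -/(ball_mass x r).
have : ln (ball_mass x r) <= ln (C * r `^ s).
  by rewrite ler_ln ?posrE ?m_gt0 ?mulr_gt0 ?powR_gt0// Hd// r0.
rewrite lnM ?posrE ?powR_gt0// ln_powR => /le_trans; apply.
have lCe : `|ln C| <= - (e * ln r).
  have : - (`|ln C| / e) * e > ln r * e by rewrite ltr_pM2r.
  by rewrite mulNr divfK ?gt_eqF//; lra.
have := ler_norm (ln C); lra.
Qed.

Lemma local_dim_le x s : measure_supp mu x ->
  (forall e (N : nat), 0 < e -> exists m c : nat, [/\ (N <= m)%N,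
     c%:R <= (s + e) * m%:R & 3 ^- c <= ball_mass x (3 ^- m)]) ->
  (local_dim mu x <= s%:E)%E.
Proof.
move=> xsupp H; rewrite /local_dim mem_set//.
apply: limf_einf_le => e d e0 d0.
have [N Nd] : exists N : nat, 3 ^- N < d.
  exists (Num.truncn d^-1).+1.
  rewrite -ltf_pV2 ?posrE ?invr_gt0 ?exprn_gt0// ?invrK.
  apply: (lt_trans (truncnS_gt _)).
  by rewrite -natrX ltr_nat ltn_expl.
have [m [c [Nm cm Hm]]] := H e N.+1 e0.
have m0 : (0 < m)%N by apply: leq_trans Nm.
exists (3 ^- m).
  rewrite invr_gt0 exprn_gt0//=; apply: le_lt_trans Nd.
  by rewrite lef_pV2 ?posrE ?exprn_gt0// ler_weXn2l ?ler1n// ltnW.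
have l3 : 0 < ln (3 : R) by rewrite ln_gt0// ltr1n.
have mpos : 0 < 3 ^+ m :> R by rewrite exprn_gt0.
have cpos : 0 < 3 ^+ c :> R by rewrite exprn_gt0.
rewrite lee_fin -/(ball_mass x _) lnV ?posrE// lnXn//.
rewrite ler_ndivrMr; last by rewrite oppr_lt0 pmulrn_lgt0.
apply: (@le_trans _ _ (ln (3 ^- c : R))); last first.
  rewrite ler_ln// ?posrE ?invr_gt0//.
  by apply: lt_le_trans Hm; rewrite invr_gt0.
rewrite lnV ?posrE// lnXn// -(mulr_natr _ m) -(mulr_natr _ c).
have := ler_wpM2r (ltW l3) cm; lra.
Qed.

Lemma local_dim_eq x y (d : R) : measure_supp mu x -> measure_supp mu y ->
  0 < d -> (forall r, 0 < r < d -> ball_mass x r = ball_mass y r) ->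
  local_dim mu x = local_dim mu y.
Proof.
move=> xsupp ysupp d0 xy; rewrite /local_dim (mem_set xsupp) (mem_set ysupp).
by apply: (limf_einf_near d0) => r rd; rewrite -/(ball_mass x r) xy.
Qed.

End local_dimension.

(** * Hausdorff dimension and translations *)

Section hausdorff.
Context {R : realType}.
Implicit Types (A B : set R) (s d t : R).

Definition translate A t : set R := [set x + t | x in A].

Lemma translate_eq0 A t : (translate A t == set0) = (A == set0).
Proof.
apply/eqP/eqP => [|->]; last by rewrite /translate image_set0.
by exact: image_set0_set0.
Qed.

Lemma diameter_translate A t : diameter (translate A t) = diameter A.
Proof.
rewrite /diameter translate_eq0; case: ifPn => // _; congr ereal_sup.
apply/seteqP; split => [_ [[x y] [/= [x' Ax' <-] [y' Ay' <-]] <-]|].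
  by exists (x', y') => //=; congr (`| _ |%:E); ring.
move=> _ [[x y] [/= Ax Ay] <-].
exists (x + t, y + t) => /=; first by split; [exists x|exists y].
by congr (`| _ |%:E); ring.
Qed.

Lemma hausdorff_weight_ge0 s A : (0 <= hausdorff_weight s A)%E.
Proof. by rewrite /hausdorff_weight; case: ifP => // _; exact: poweR_ge0. Qed.

Lemma hausdorff_weight_translate s A t :
  hausdorff_weight s (translate A t) = hausdorff_weight s A.
Proof. by rewrite /hausdorff_weight translate_eq0 diameter_translate. Qed.

Lemma hausdorff_content_ge0 s d A : (0 <= hausdorff_content s d A)%E.
Proof.
apply: le_ereal_inf_tmp => _ [B _ <-].
by apply: nneseries_ge0 => k _ _; exact: hausdorff_weight_ge0.
Qed.

Lemma hausdorff_measure_eq0P s A : hausdorff_measure s A = 0%E <->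
  forall d e, 0 < d -> 0 < e -> exists B : nat -> set R,
    [/\ A `<=` \bigcup_k B k, forall k, (diameter (B k) <= d%:E)%E &
        (\sum_(0 <= k <oo) hausdorff_weight s (B k) <= e%:E)%E].
Proof.
split=> [HA0 d e d0 e0|H].
  have : (hausdorff_content s d A < e%:E)%E.
    apply: (@le_lt_trans _ _ 0%E); last by rewrite lte_fin.
    by rewrite -HA0; apply: ereal_sup_ubound; exists d.
  move=> /ereal_inf_lt[_ [B [AB Bd] <-] /ltW Be].
  by exists B.
apply/eqP; rewrite eq_le; apply/andP; split; last first.
  apply: le_ereal_sup_tmp; exists (hausdorff_content s 1 A).
    by exists 1 => //=.
  exact: hausdorff_content_ge0.
apply: ge_ereal_sup => _ [d /= d0 <-].
apply/lee_addgt0Pr => e e0; rewrite add0e.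
have [B [AB Bd Be]] := H _ _ d0 e0.
by apply: ge_ereal_inf; exists (\sum_(0 <= k <oo) hausdorff_weight s (B k))%E => //;
  exists B.
Qed.

Lemma sum_divn (f : nat -> \bar R) (N n : nat) : (0 < N)%N ->
  (\sum_(0 <= k < n * N) f (k %/ N)%N = \sum_(0 <= q < n) \sum_(0 <= j < N) f q)%E.
Proof.
move=> N0; elim: n => [|n IHn]; first by rewrite mul0n !big_geq.
rewrite big_nat_recr//= -IHn mulSnr (big_cat_nat (n := n * N))//= ?leq_addr//.
congr (_ + _)%E; rewrite -{1}[(n * N)%N]add0n big_addn addnC addnK.
apply: eq_big_nat => j /andP[_ jN].
by rewrite addnC divnMDl// divn_small// addn0.
Qed.

(** A cover [C] of [A] yields the cover of all [N] translates by the sets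
    [translate (C q) (t j)], enumerated by [k = q * N + j]. *)
Lemma hausdorff_measure_translates s A B (t : nat -> R) (N : nat) :
  B `<=` \bigcup_(j in `I_N) translate A (t j) ->
  hausdorff_measure s A = 0%E -> hausdorff_measure s B = 0%E.
Proof.
move=> BA /hausdorff_measure_eq0P HA; apply/hausdorff_measure_eq0P => d e d0 e0.
have [N0|N0] := posnP N.
  exists (fun=> set0); split.
  - by move=> x /BA[j]; rewrite N0.
  - by move=> k; rewrite /diameter eqxx lee_fin ltW.
  - by rewrite eseries0 ?lee_fin ?ltW// => k _ _; rewrite /hausdorff_weight eqxx.
have N0' : 0 < N%:R :> R by rewrite ltr0n.
have [C [AC Cd Ce]] := HA d (e / N%:R) d0 (divr_gt0 e0 N0').
exists (fun k => translate (C (k %/ N)%N) (t (k %% N)%N)); split.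
- move=> x /BA[j /= jN [y /AC[q _ Cqy] <-]]; exists (q * N + j)%N => //.
  by rewrite divnMDl// divn_small// addn0 modnMDl modn_small//; exists y.
- by move=> k; rewrite diameter_translate.
under eq_eseriesr do rewrite hausdorff_weight_translate.
apply: lime_le.
  by apply: is_cvg_nneseries => k _ _; exact: hausdorff_weight_ge0.
near=> n.
apply: (@le_trans _ _ (\sum_(0 <= k < n * N) hausdorff_weight s (C (k %/ N)%N))%E).
  by apply: lee_sum_nneg_natr => [k _ _|]; [exact: hausdorff_weight_ge0|
    exact: leq_pmulr].
rewrite (@sum_divn (fun q => hausdorff_weight s (C q)))// exchange_big_nat/=.
apply: (@le_trans _ _ (\sum_(0 <= j < N) (e / N%:R)%:E)%E).
  apply: lee_sum => j _; apply: le_trans Ce.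
  by apply: nneseries_lim_ge => k _ _; exact: hausdorff_weight_ge0.
by rewrite sumEFin sumr_const_nat subn0 -(mulr_natr (e / _)) divfK ?gt_eqF.
Unshelve. all: by end_near. Qed.

Lemma hausdorff_dim_translates A B (t : nat -> R) (N : nat) :
  B `<=` \bigcup_(j in `I_N) translate A (t j) ->
  (hausdorff_dim B <= hausdorff_dim A)%E.
Proof.
move=> BA; rewrite /hausdorff_dim; case: ifPn => [_|/set0P[x Bx]].
  by case: ifPn => // _; rewrite leNye.
case: ifPn => [/eqP A0|_].
  by have [j _] := BA _ Bx; rewrite A0 => -[y []].
apply: ereal_inf_le_tmp => _ [s [s0 sA] <-]; exists s => //; split => //.
exact: hausdorff_measure_translates BA sA.
Qed.

Lemma hausdorff_dim_subset A B : A `<=` B ->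
  (hausdorff_dim A <= hausdorff_dim B)%E.
Proof.
move=> AB; apply: (@hausdorff_dim_translates _ _ (fun=> 0) 1) => x Ax.
by exists 0%N => //; exists x; [exact: AB|rewrite addr0].
Qed.

Lemma hausdorff_dim_ge0 A : (0 <= hausdorff_dim A)%E <-> A !=set0.
Proof.
rewrite /hausdorff_dim; case: ifPn => [/eqP ->|/set0P A0].
  by split => // -[].
split=> // _; apply: le_ereal_inf_tmp => _ [s [s0 _] <-].
by rewrite lee_fin.
Qed.

End hausdorff.

(** * Nested triadic grids and their midpoints *)

HB.lock Definition level (k : nat) : nat := (k.+2)`!.

HB.lock Definition den (k : nat) : nat := (3 ^ level k)%N.

Lemma levelS k : level k.+1 = (k.+3 * level k)%N.
Proof. by rewrite !level.unlock factS. Qed.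

Lemma level_ge k : (k.+2 <= level k)%N.
Proof. by rewrite level.unlock factS leq_pmulr// fact_gt0. Qed.

Lemma leq_level k l : (k <= l)%N -> (level k <= level l)%N.
Proof. by move=> kl; rewrite level.unlock; exact: leq_fact. Qed.

Lemma denE k : den k = (3 ^ level k)%N.
Proof. by rewrite den.unlock. Qed.

Lemma den_gt0 k : (0 < den k)%N.
Proof. by rewrite denE expn_gt0. Qed.

Lemma den_odd_multiple k l : (k <= l)%N ->
  exists c : nat, den l = (den k * c.*2.+1)%N.
Proof.
move=> kl; exists (3 ^ (level l - level k))%N./2.
have -> : ((3 ^ (level l - level k))./2.*2.+1 = 3 ^ (level l - level k))%N.
  by rewrite -[RHS]odd_double_half oddX orbT.
by rewrite !denE -expnD subnKC// leq_level.
Qed.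

Section grids.
Context {R : realType}.
Implicit Types (x y p t : R).

Definition denR k : R := (den k)%:R.

Lemma denR_gt0 k : 0 < denR k.
Proof. by rewrite ltr0n den_gt0. Qed.

Lemma denR_neq0 k : denR k != 0.
Proof. by rewrite gt_eqF// denR_gt0. Qed.

Lemma denRE k : denR k = 3 ^+ level k.
Proof. by rewrite /denR denE natrX. Qed.

Definition grid k x := exists z : int, x = z%:~R / denR k.

Definition hole k x := exists z : int, x = (z%:~R + 2^-1) / denR k.

Lemma denR_odd_multiple k l : (k <= l)%N ->
  exists c : nat, denR l = denR k * (2 * c%:R + 1).
Proof.
move=> /den_odd_multiple[c kl]; exists c.
by rewrite /denR kl natrM -addn1 natrD -mul2n natrM.
Qed.

Lemma grid_le k l x : (k <= l)%N -> grid k x -> grid l x.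
Proof.
move=> /denR_odd_multiple[c kl] [z ->]; exists (z * (2 * c%:Z + 1)).
have c0 : 2 * c%:R + 1 != 0 :> R by rewrite gt_eqF// ltr_wpDl// mulr_ge0.
rewrite kl rmorphM rmorphD rmorphM /= -pmulrn.
by field; rewrite c0 denR_neq0.
Qed.

Lemma hole_le k l x : (k <= l)%N -> hole k x -> hole l x.
Proof.
move=> /denR_odd_multiple[c kl] [z ->]; exists (z * (2 * c%:Z + 1) + c%:Z).
have c0 : 2 * c%:R + 1 != 0 :> R by rewrite gt_eqF// ltr_wpDl// mulr_ge0.
rewrite kl !(rmorphM, rmorphD) /= -!pmulrn.
by field; rewrite c0 denR_neq0.
Qed.

Lemma gridD k x y : grid k x -> grid k y -> grid k (x + y).
Proof. by move=> [z ->] [w ->]; exists (z + w); rewrite intrD mulrDl. Qed.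

Lemma gridN k x : grid k x -> grid k (- x).
Proof. by move=> [z ->]; exists (- z); rewrite intrN mulNr. Qed.

Lemma gridB k x y : grid k x -> grid k y -> grid k (x - y).
Proof. by move=> kx ky; apply: gridD => //; exact: gridN. Qed.

Lemma grid_nat k (j : nat) : grid k (j%:R / denR k).
Proof. by exists j%:Z; rewrite -pmulrn. Qed.

Lemma holeD k x t : hole k x -> grid k t -> hole k (x + t).
Proof.
move=> [z ->] [w ->]; exists (z + w).
by rewrite intrD -mulrDl; congr (_ / _); ring.
Qed.

Lemma grid_sep k x : grid k x -> `|x| < (denR k)^-1 -> x = 0.
Proof.
move=> [z ->]; rewrite normrM normfV (gtr0_norm (denR_gt0 k)).
rewrite ltr_pdivrMr ?denR_gt0// mulVf ?denR_neq0// -intr_norm ltrz1 => z1.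
suff -> : z = 0 by rewrite mul0r.
by apply/eqP; rewrite -normr_le0; lia.
Qed.

Lemma hole_grid_dist k p x : hole k p -> grid k x ->
  (denR k)^-1 / 2 <= `|x - p|.
Proof.
move=> [z ->] [w ->]; rewrite -mulrBl normrM normfV (gtr0_norm (denR_gt0 k)).
rewrite mulrC ler_pM2r ?invr_gt0 ?denR_gt0//.
rewrite opprD addrA -intrB; set v := (w - z)%R.
have [v0|v1] : v <= 0 \/ 1 <= v by lia.
  rewrite ler0_norm; first by have : v%:~R <= 0 :> R by [rewrite lerz0]; lra.
  by have : v%:~R <= 0 :> R by [rewrite lerz0]; lra.
rewrite ger0_norm; first by have : 1 <= v%:~R :> R by [rewrite ler1z]; lra.
by have : 1 <= v%:~R :> R by [rewrite ler1z]; lra.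
Qed.

(** Distance to the nearest point of [hole k]. *)
Definition gap k x : R :=
  `|denR k * x - (Num.floor (denR k * x))%:~R - 2^-1| / denR k.

Lemma gap_ge0 k x : 0 <= gap k x.
Proof. by rewrite divr_ge0// ltW ?denR_gt0. Qed.

Lemma gap_attained k x : exists2 p, hole k p & gap k x = `|x - p|.
Proof.
exists (((Num.floor (denR k * x))%:~R + 2^-1) / denR k).
  by exists (Num.floor (denR k * x)).
rewrite /gap -[X in _ / X](gtr0_norm (denR_gt0 k)) -normf_div.
by congr `| _ |; field; exact: denR_neq0.
Qed.

Lemma gap_le k x p : hole k p -> gap k x <= `|x - p|.
Proof.
move=> [z ->].
have -> : x - (z%:~R + 2^-1) / denR k = (denR k * x - z%:~R - 2^-1) / denR k.
  by field; exact: denR_neq0.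
rewrite /gap normrM normfV (gtr0_norm (denR_gt0 k)) ler_pM2r ?invr_gt0 ?denR_gt0//.
set y := denR k * x; have /andP[] := floor_itv y.
set n := Num.floor y; rewrite intrD => ny yn.
have nz_itv : `|y - n%:~R - 2^-1| <= 2^-1 by rewrite ler_norml; apply/andP; split; lra.
have [zn|nz|->//] := ltrgtP z n.
  have : (z + 1)%:~R <= n%:~R :> R by rewrite ler_int lezD1.
  rewrite intrD => zn'; apply: (le_trans nz_itv).
  by apply: le_trans (ler_norm _); lra.
have : (n + 1)%:~R <= z%:~R :> R by rewrite ler_int lezD1.
rewrite intrD => nz'; apply: (le_trans nz_itv).
by rewrite -normrN; apply: le_trans (ler_norm _); lra.
Qed.

Lemma gap_lip k x y : gap k x <= gap k y + `|x - y|.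
Proof.
have [p pk ->] := gap_attained k y; apply: (le_trans (gap_le x pk)).
by rewrite [leRHS]addrC; exact: ler_distD.
Qed.

Lemma gap_half k x : gap k x <= (denR k)^-1 / 2.
Proof.
rewrite /gap mulrC ler_pM2l ?invr_gt0 ?denR_gt0//.
have /andP[] := floor_itv (denR k * x); rewrite intrD => ny yn.
by rewrite ler_norml; apply/andP; split; lra.
Qed.

(** [hole i] consists of midpoints of [grid k] as well. *)
Lemma gap_grid i k x : (i <= k)%N -> grid k x -> (denR k)^-1 / 2 <= gap i x.
Proof.
move=> ik kx; have [p /(hole_le ik) kp ->] := gap_attained i x.
exact: hole_grid_dist.
Qed.

Lemma gap_grid_gt0 i k x : (i <= k)%N -> grid k x -> 0 < gap i x.
Proof.
move=> ik kx; apply: lt_le_trans (gap_grid ik kx).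
by rewrite divr_gt0// invr_gt0 denR_gt0.
Qed.

Lemma gap_periodic k x t : grid k t -> gap k (x + t) = gap k x.
Proof.
have le_gap y s : grid k s -> gap k (y + s) <= gap k y.
  move=> ks; have [p pk ->] := gap_attained k y.
  have := gap_le (y + s) (holeD pk ks); congr (_ <= `| _ |); ring.
move=> kt; apply/eqP; rewrite eq_le le_gap//=.
by rewrite -{1}[x](addrK t) le_gap//; exact: gridN.
Qed.

(** The nearest points of [hole k] and [hole k.+1] both lie in [hole k.+1], whose
    points are [1 / den k.+1] apart, so that they coincide. The same hole is
    therefore approached at all scales. *)
Lemma gap_small_hole x K :
  (forall k, (K <= k)%N -> gap k x < (denR k.+1)^-1 / 4) -> exists k, hole k x.
Proof.
move=> xK; exists K.
have qS k : (denR k.+1)^-1 <= (denR k)^-1.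
  by rewrite lef_pV2 ?posrE ?denR_gt0// ler_nat !denE leq_pexp2l// leq_level.
have [p pK xp] := gap_attained K x.
have near k : (K <= k)%N -> `|x - p| < (denR k.+1)^-1 / 4.
  elim: k => [|k IHk] Kk.
    by move: Kk; rewrite leqn0 => /eqP K0; subst K; rewrite -xp xK.
  move: Kk; rewrite leq_eqVlt => /predU1P[<-|]; first by rewrite -xp xK.
  rewrite ltnS => Kk; have xp1 := IHk Kk.
  have [p' pk' xp'] := gap_attained k.+1 x.
  have := xK k.+1 (leqW Kk); rewrite xp' => xp2.
  suff <- : p' = p by [].
  apply/eqP; rewrite -subr_eq0; apply/eqP; apply: (@grid_sep k.+1).
    have [w ->] := hole_le (leqW Kk) pK; have [z ->] := pk'.
    by exists (z - w); rewrite -mulrBl intrB; congr (_ / _); ring.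
  have -> : p' - p = (x - p) - (x - p') by ring.
  apply: (le_lt_trans (ler_normB _ _)).
  have := qS k.+1; have : 0 < (denR k.+1)^-1 by rewrite invr_gt0 denR_gt0.
  lra.
suff -> : x = p by [].
apply/eqP; rewrite -subr_eq0 -normr_le0 leNgt; apply/negP => xp0.
pose N := (Num.truncn `|x - p|^-1).+1.
have := near (K + N)%N (leq_addr _ _); apply/negP; rewrite -leNgt.
have N0 : 0 < N%:R :> R by rewrite ltr0n.
apply: (@le_trans _ _ N%:R^-1).
  have : N%:R <= denR (K + N).+1.
    rewrite ler_nat denE; apply: (@leq_trans (level (K + N).+1)).
      by apply: leq_trans (level_ge _); lia.
    by apply: ltnW; rewrite ltn_expl.
  have q0 := denR_gt0 (K + N).+1.
  rewrite -lef_pV2 ?posrE// => /(le_trans _); apply.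
  by have : 0 < (denR (K + N).+1)^-1 by [rewrite invr_gt0]; lra.
by rewrite invf_ple ?posrE// ltW// truncnS_gt.
Qed.

End grids.

(** * The purely atomic measure *)

Section counting_integers.
Context {R : realType}.

Lemma sum_itv_le (u v : R) (N : nat) : 0 <= v - u + 1 ->
  \sum_(0 <= j < N) (u < j%:R < v)%R%:R <= v - u + 1.
Proof.
move=> uv0.
(* Measuring only the length already passed makes the bound inductive. *)
suff : \sum_(0 <= j < N) (u < j%:R < v)%R%:R <=
    Num.max 0 (Num.min N%:R (v + 1) - u).
  move=> /le_trans; apply; rewrite ge_max uv0/=.
  by have : Num.min N%:R (v + 1) <= v + 1 by [rewrite ge_min lexx orbT]; lra.
elim: N => [|N IHN]; first by rewrite big_geq// le_max lexx.
rewrite big_nat_recr//=; have [/andP[uN Nv]|_] := boolP (u < N%:R < v).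
  move: IHN; rewrite min_l; last by lra.
  rewrite max_r; last lra.
  rewrite -[N.+1%:R]natr1 min_l; last lra.
  by rewrite mulr1n max_r; lra.
rewrite addr0; apply: (le_trans IHN); rewrite ge_max le_max lexx/=.
rewrite le_max lerD2r le_min !ge_min lexx orbT andbT.
by rewrite ler_nat leqnSn orbT.
Qed.

End counting_integers.

Section atomic_measure.
Context {R : realType}.
Implicit Types (A : set R) (x r : R).

Definition atom (k j : nat) : R := j%:R / denR k.+2.

(** Two depths separate the atoms from the holes that thin them out. A point
    avoiding holes is known to be at distance about [1 / den k.+1] from [hole k],
    which is a negligible loss only at the scale [1 / den k.+2]. *)
Definition atom_weight (k j : nat) : R := gap k (atom k j) / denR k.+2.

Lemma atom_weight_ge0 k j : 0 <= atom_weight k j.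
Proof. by rewrite divr_ge0 ?gap_ge0// ltW// denR_gt0. Qed.

Definition layer (k : nat) A : R :=
  \sum_(0 <= j < (den k.+2).+1) atom_weight k j * \1_A (atom k j).

Lemma half_pow_ge0 k : 0 <= ((2 ^ k.+1)%:R^-1 : R).
Proof. by rewrite invr_ge0 ler0n. Qed.

Definition gap_measure : set (measurableTypeR R) -> \bar R :=
  mseries (fun k => mscale (NngNum (half_pow_ge0 k))
    (msum (fun j => mscale (NngNum (atom_weight_ge0 k j))
                           (dirac (atom k j : measurableTypeR R)))
          (den k.+2).+1)) 0.

HB.instance Definition _ := Measure.on gap_measure.

Lemma gap_measureE A :
  gap_measure A = (\sum_(0 <= k <oo) (layer k A / (2 ^ k.+1)%:R)%:E)%E.
Proof.
apply: eq_eseriesr => k _; rewrite /mscale /msum /= EFinM muleC; congr (_ * _)%E.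
by rewrite /layer big_mkord -sumEFin; apply: eq_bigr => j _; rewrite EFinM.
Qed.

Lemma layer_ge0 k A : 0 <= layer k A.
Proof. by apply: sumr_ge0 => j _; rewrite mulr_ge0 ?atom_weight_ge0. Qed.

Lemma gap_measure_le A (C : R) : 0 <= C -> (forall k, layer k A <= C) ->
  (gap_measure A <= C%:E)%E.
Proof.
move=> C0 AC; rewrite gap_measureE; apply: le_trans (epsilon_trick0 xpredT C0).
apply: lee_nneseries => [k _ _|k _]; rewrite lee_fin.
  by rewrite divr_ge0 ?layer_ge0.
by rewrite ler_pM2r ?AC// invr_gt0 ltr0n expn_gt0.
Qed.

Lemma layer_ball_le k x r (W : R) : 0 < r -> 0 <= W ->
  (forall j : nat, `|x - atom k j| < r -> atom_weight k j <= W) ->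
  layer k (ball x r) <= W * (2 * (r * denR k.+2) + 1).
Proof.
move=> r0 W0 HW; have q0 : 0 < denR k.+2 :> R by exact: denR_gt0.
pose u := (x - r) * denR k.+2; pose v := (x + r) * denR k.+2.
have uv : v - u + 1 = 2 * (r * denR k.+2) + 1 by rewrite /u /v; ring.
have uv0 : 0 <= v - u + 1 by rewrite uv addr_ge0// mulr_ge0// mulr_ge0// ltW.
rewrite -uv; apply: le_trans (ler_wpM2l W0 (sum_itv_le (den k.+2).+1 uv0)).
rewrite big_distrr/=; apply: ler_sum => j _.
rewrite indicE.
have -> : (atom k j \in (ball x r : set R)) = (`|x - atom k j| < r).
  by apply/idP/idP => [/set_mem//|?]; exact: mem_set.
have ja : j%:R = atom k j * denR k.+2 by rewrite /atom divfK ?gt_eqF.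
have -> : (`|x - atom k j| < r) = (u < j%:R < v).
  rewrite ja /u /v !ltr_pM2r// ltr_norml.
  by apply/idP/idP => /andP[? ?]; apply/andP; split; lra.
have [|_] := boolP (u < j%:R < v); last by rewrite !mulr0.
rewrite ja /u /v !ltr_pM2r// => /andP[? ?]; rewrite !mulr1; apply: HW.
by rewrite ltr_norml; apply/andP; split; lra.
Qed.

Lemma layer_ball_eq0 k x r :
  (forall j : nat, r <= `|x - atom k j|) -> layer k (ball x r) = 0.
Proof.
move=> H; apply: big1 => j _; rewrite indicE memNset ?mulr0//=.
by rewrite /ball /= => /lt_geF; rewrite H.
Qed.

Lemma layer_le1 k A : layer k A <= 1.
Proof.
have q0 : 0 < denR k.+2 :> R by exact: denR_gt0.
have q1 i : 1 <= denR i :> R by rewrite ler1n den_gt0.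
apply: (@le_trans _ _ (\sum_(0 <= j < (den k.+2).+1) (denR k.+2)^-1 / 2)).
  apply: ler_sum => j _; apply: (@le_trans _ _ (atom_weight k j)).
    by rewrite ler_piMr ?atom_weight_ge0// indicE; case: (_ \in _).
  rewrite /atom_weight mulrC ler_pM2l ?invr_gt0//.
  apply: (le_trans (gap_half k _)); rewrite ler_piMl// invf_le1//.
  exact: denR_gt0.
rewrite sumr_const_nat subn0 -(mulr_natr (_ / 2)) -[(den k.+2).+1%:R]natr1.
rewrite -/(denR k.+2).
rewrite mulrDr mulr1 -mulrA (mulrC 2^-1) mulrA mulVf ?gt_eqF// mul1r.
by have : (denR k.+2)^-1 <= 1 :> R by [rewrite invf_le1]; lra.
Qed.

Lemma gap_measure_fin : fin_num_fun gap_measure.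
Proof.
apply: lty_fin_num_fun; apply: le_lt_trans (ltry 1).
by apply: gap_measure_le => // k; exact: layer_le1.
Qed.

HB.instance Definition _ :=
  @Measure_isFinite.Build _ _ _ gap_measure gap_measure_fin.

Definition mu_gap : {finite_measure set (measurableTypeR R) -> \bar R} :=
  gap_measure.

Lemma ball_mass_fin x r : mu_gap (ball x r) \is a fin_num.
Proof.
by apply: fin_num_measure; apply: open_measurable; exact: ball_open.
Qed.

Lemma ball_mass_le x r (C : R) : 0 <= C ->
  (forall k, layer k (ball x r) <= C) -> ball_mass mu_gap x r <= C.
Proof.
by move=> C0 /(gap_measure_le C0) H; rewrite -lee_fin fineK ?ball_mass_fin.
Qed.

Lemma gap_measure_ge A k j : (j <= den k.+2)%N -> A (atom k j) ->
  ((atom_weight k j / (2 ^ k.+1)%:R)%:E <= gap_measure A)%E.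
Proof.
move=> jk Aj; rewrite gap_measureE.
apply: (@le_trans _ _ (layer k A / (2 ^ k.+1)%:R)%:E).
  rewrite lee_fin ler_pM2r ?invr_gt0 ?ltr0n ?expn_gt0// /layer.
  rewrite (bigD1_seq j) ?mem_index_iota ?iota_uniq//= indicE mem_set// mulr1.
  by rewrite lerDl sumr_ge0// => i _; rewrite mulr_ge0 ?atom_weight_ge0.
have lay0 i : (0 <= (layer i A / (2 ^ i.+1)%:R)%:E)%E.
  by rewrite lee_fin divr_ge0 ?layer_ge0.
apply: le_trans (nneseries_lim_ge k.+1 _) => //.
by rewrite big_nat_recr//= leeDr// sume_ge0.
Qed.

Lemma ball_mass_ge x r k j : (j <= den k.+2)%N -> `|x - atom k j| < r ->
  atom_weight k j / (2 ^ k.+1)%:R <= ball_mass mu_gap x r.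
Proof.
move=> jk xj; rewrite -lee_fin fineK ?ball_mass_fin//.
exact: gap_measure_ge.
Qed.

Lemma ball_mass_eq x y r :
  (forall k, layer k (ball x r) = layer k (ball y r)) ->
  ball_mass mu_gap x r = ball_mass mu_gap y r.
Proof.
move=> xy; rewrite /ball_mass; congr fine; rewrite /= !gap_measureE.
by apply: eq_eseriesr => k _; rewrite xy.
Qed.

Lemma atom_grid k j : grid k.+2 (atom k j).
Proof. exact: grid_nat. Qed.

Lemma atom_weight_gt0 k j : 0 < atom_weight k j.
Proof.
rewrite divr_gt0 ?denR_gt0//; apply: gap_grid_gt0 (atom_grid k j).
by rewrite leqW.
Qed.

End atomic_measure.

(** * Local dimensions of the measure *)

Section local_dimensions.
Context {R : realType}.
Implicit Types (x y p r e s : R).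

Local Notation mu := (@mu_gap R).

Lemma level_growth e : 0 < e -> exists K : nat,
  forall k, (K <= k)%N -> (2 * level k.+1)%:R <= e * (level k.+2)%:R.
Proof.
move=> e0; exists (Num.truncn (2 / e)).+1 => k Kk.
rewrite (levelS k.+1) !natrM mulrA ler_pM2r ?ltr0n; last first.
  exact: leq_trans (level_ge _).
rewrite -ler_pdivrMl// mulrC; apply/ltW.
by apply: lt_le_trans (truncnS_gt _) _; rewrite ler_nat !leqW.
Qed.

Lemma grid_atom k x : 0 <= x <= 1 -> grid k.+2 x ->
  exists2 j : nat, (j <= den k.+2)%N & x = atom k j.
Proof.
have q0 : 0 < denR k.+2 :> R by exact: denR_gt0.
move=> /andP[x0 x1] [z xz]; move: x0 x1; rewrite xz.
rewrite pmulr_lge0 ?invr_gt0// ler0z ler_pdivrMr// mul1r.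
case: z {xz} => // j _; rewrite /denR -pmulrn ler_nat => jk.
by exists j.
Qed.

Lemma atom_near k x : 0 <= x <= 1 ->
  exists2 j : nat, (j <= den k.+2)%N & `|x - atom k j| < (denR k.+2)^-1.
Proof.
have q0 : 0 < denR k.+2 :> R by exact: denR_gt0.
move=> /andP[x0 x1]; exists (Num.truncn (x * denR k.+2)).
  rewrite -(ler_nat R); apply: (@le_trans _ _ (x * denR k.+2)).
    by rewrite truncn_le// mulr_ge0// ltW.
  by rewrite ler_piMl// ltW.
have jx : (Num.truncn (x * denR k.+2))%:R <= x * denR k.+2.
  by rewrite truncn_le// mulr_ge0// ltW.
have xj : x * denR k.+2 < (Num.truncn (x * denR k.+2))%:R + 1.
  by rewrite natr1 truncnS_gt.
have -> : x - atom k (Num.truncn (x * denR k.+2)) =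
    (x * denR k.+2 - (Num.truncn (x * denR k.+2))%:R) / denR k.+2.
  by rewrite /atom; field; rewrite gt_eqF.
rewrite normrM normfV (gtr0_norm q0) -[ltRHS]mul1r ltr_pM2r ?invr_gt0//.
by rewrite ger0_norm; lra.
Qed.

Lemma inv_den_small (d : R) : 0 < d -> exists K : nat,
  forall k, (K <= k)%N -> (denR k.+2)^-1 < d.
Proof.
move=> d0; exists (Num.truncn d^-1).+1 => k Kk.
rewrite -ltf_pV2 ?posrE ?invr_gt0 ?denR_gt0// invrK.
apply: (lt_trans (truncnS_gt _)); rewrite ltr_nat denE.
apply: (leq_ltn_trans _ (ltn_expl _ (isT : (1 < 3)%N))).
by apply: leq_trans (level_ge _); rewrite (leq_trans Kk)// !leqW.
Qed.

Lemma ball_mass_gt0 x r : 0 <= x <= 1 -> 0 < r -> 0 < ball_mass mu x r.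
Proof.
move=> x01 r0; have [K /(_ _ (leqnn _)) Kr] := inv_den_small r0.
have [j jK xj] := atom_near K x01.
apply: lt_le_trans (ball_mass_ge jK (lt_trans xj Kr)).
by rewrite divr_gt0 ?atom_weight_gt0 ?ltr0n ?expn_gt0.
Qed.

Lemma measure_supp_gap : measure_supp mu = [set x | 0 <= x <= 1].
Proof.
apply/seteqP; split => [x /(_ [set x | 0 <= x <= 1])/=|x /= x01 F /= [Fc F0]].
  apply; split.
    have -> : [set x : R | 0 <= x <= 1] = `[0, 1]%classic.
      by apply/seteqP; split => y; rewrite /= in_itv.
    exact: interval_closed.
  apply/eqP; rewrite -measure_le0; apply: gap_measure_le => // k.
  rewrite /layer big_nat_cond big1// => j /andP[/andP[_ jk] _].
  rewrite indicE memNset ?mulr0//=; apply; apply/andP; split.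
    by rewrite divr_ge0// ltW// denR_gt0.
  by rewrite ler_pdivrMr ?denR_gt0// mul1r ler_nat -ltnS.
apply: contrapT => nFx.
have /nbhs_ballP[r /= r0 rF] : nbhs x (~` F).
  by apply: open_nbhs_nbhs; split => //; exact: closed_openC.
have := ball_mass_gt0 x01 r0; apply/negP; rewrite -leNgt -lee_fin.
rewrite fineK ?ball_mass_fin// [leRHS](_ : _ = mu (~` F)); last exact: esym F0.
apply: le_measure => //; rewrite inE; apply: open_measurable.
  exact: ball_open.
exact: closed_openC.
Qed.

Lemma gap_measure_dim_ge x s (C : R) : 0 <= x <= 1 -> 0 < C ->
  (exists2 d, 0 < d &
    forall r k, 0 < r < d -> layer k (ball x r) <= C * r `^ s) ->
  (s%:E <= local_dim mu x)%E.
Proof.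
move=> x01 C0 [d d0 xd]; apply: (@local_dim_ge _ _ _ _ C) => //.
- by rewrite measure_supp_gap.
- by move=> r; exact: ball_mass_gt0.
exists d => // r rd; apply: ball_mass_le => [|k]; last exact: xd.
by rewrite mulr_ge0 ?powR_ge0// ltW.
Qed.

(** An atom of the [k]th layer close to [x] bounds the local dimension at [x] by
    the exponent of its weight, the factor [2 ^- k.+1] being absorbed in [3 ^- k.+1]. *)
Lemma gap_measure_dim_le x s : 0 <= x <= 1 ->
  (forall e (N : nat), 0 < e -> exists k j m b : nat,
    [/\ (N <= m)%N /\ (j <= den k.+2)%N, `|x - atom k j| < 3 ^- m,
        3 ^- b <= gap k (atom k j : R) &
        (b + level k.+2 + k.+1)%:R <= (s + e) * m%:R]) ->
  (local_dim mu x <= s%:E)%E.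
Proof.
move=> x01 H; apply: local_dim_le => [|e N e0]; first by rewrite measure_supp_gap.
have [k [j [m [b [[Nm jk] xj bj cm]]]]] := H _ N e0.
exists m, (b + level k.+2 + k.+1)%N; split => //.
apply: le_trans (ball_mass_ge jk xj).
rewrite 2!exprD 2!invfM /atom_weight denRE; apply: ler_pM => //.
  by rewrite ler_pM2r// invr_gt0 exprn_gt0.
by rewrite natrX lef_pV2 ?posrE ?exprn_gt0// lerXn2r ?nnegrE// ler_nat.
Qed.

Lemma denRV_3X k : (denR k)^-1 = 3 ^- level k :> R.
Proof. by rewrite denRE. Qed.

Lemma denRV_step k : (denR k.+1)^-1 <= (denR k)^-1 / 9 :> R.
Proof.
rewrite -invfM lef_pV2 ?posrE ?mulr_gt0 ?denR_gt0// !denRE.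
have -> : 9 = 3 ^+ 2 :> R by rewrite expr2; ring.
rewrite -exprD ler_weXn2l ?ler1n// levelS.
have := level_ge k; lia.
Qed.

(** In a ball of radius [r] around the hole, the atoms of a deep layer weigh at
    most [r / den k.+2]. None is closer to [p] than half the spacing, so that
    their number is at most [4 * r * den k.+2] for all [r]. *)
Lemma local_dim_hole_ge p k0 : 0 <= p <= 1 -> hole k0 p -> (2%:E <= local_dim mu p)%E.
Proof.
move=> p01 pk0; apply: (@gap_measure_dim_ge _ _ 4) => //.
exists ((denR k0.+1)^-1 / 2); first by rewrite divr_gt0 ?invr_gt0 ?denR_gt0.
move=> r k /andP[r0 rd].
have q0 : 0 < denR k.+2 :> R by exact: denR_gt0.
have [kk0|k0k] := ltnP k k0.
  rewrite layer_ball_eq0 ?mulr_ge0 ?powR_ge0// => j.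
  apply: (le_trans (ltW rd)); rewrite distrC; apply: hole_grid_dist.
    exact: hole_le pk0.
  by apply: grid_le (atom_grid k j); rewrite ltnS.
have [rq|qr] := leP r ((denR k.+2)^-1 / 2).
  rewrite layer_ball_eq0 ?mulr_ge0 ?powR_ge0// => j.
  apply: (le_trans rq); rewrite distrC; apply: hole_grid_dist (atom_grid k j).
  by apply: hole_le pk0; rewrite !leqW.
have W0 : 0 <= r / denR k.+2 by rewrite divr_ge0// ltW.
apply: (le_trans (layer_ball_le r0 W0 _)).
  move=> j pj; rewrite ler_pM2r ?invr_gt0//; apply: le_trans (ltW pj).
  by rewrite distrC; apply: gap_le; exact: hole_le pk0.
rewrite (powR_mulrn 2) ?(ltW r0)//.
have rq1 : 1 < 2 * (r * denR k.+2).
  have : (denR k.+2)^-1 / 2 * denR k.+2 < r * denR k.+2 by rewrite ltr_pM2r.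
  have -> : (denR k.+2)^-1 / 2 * denR k.+2 = 2^-1 :> R by field; rewrite gt_eqF.
  lra.
apply: (@le_trans _ _ (r / denR k.+2 * (4 * (r * denR k.+2)))).
  by rewrite ler_wpM2l//; lra.
by rewrite le_eqVlt; apply/orP; left; apply/eqP; field; rewrite gt_eqF.
Qed.

(** Atoms of depth [k.+2] are at least half a spacing away from the holes. *)
Lemma local_dim_le2 x : 0 <= x <= 1 -> (local_dim mu x <= 2%:E)%E.
Proof.
move=> x01; apply: gap_measure_dim_le => // e N e0.
have [K HK] := level_growth e0.
pose k := maxn K N; have [j jk xj] := atom_near k x01.
exists k, j, (level k.+2), (level k.+2).+1; split => //.
- by split => //; apply: leq_trans (level_ge _); rewrite !leqW// leq_maxr.
- by rewrite -denRV_3X.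
- apply: le_trans (gap_grid (leqW (leqnSn k)) (atom_grid k j)).
  rewrite exprSr invfM -denRV_3X ler_pM2l ?invr_gt0 ?denR_gt0//.
  by rewrite lef_pV2 ?posrE// ler_nat.
have := HK k (leq_maxl _ _); rewrite mulrDl.
have -> : ((level k.+2).+1 + level k.+2 + k.+1 =
  2 * level k.+2 + k.+2)%N by lia.
move=> le_e; rewrite [(_ + k.+2)%:R]natrD natrM lerD2l; apply: le_trans le_e.
by rewrite ler_nat; have := level_ge k.+1; lia.
Qed.

Lemma local_dim_not_hole_le x : 0 <= x <= 1 -> ~ (exists k, hole k x) ->
  (local_dim mu x <= 1%:E)%E.
Proof.
move=> x01 xh; apply: gap_measure_dim_le => // e N e0.
have [K HK] := level_growth e0.
have [k [Kk xk]] : exists k, (maxn K N <= k)%N /\ (denR k.+1)^-1 / 4 <= gap k x.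
  apply: contrapT => /forallNP H; apply: xh; apply: (@gap_small_hole _ _ (maxn K N)).
  by move=> k Kk; rewrite ltNge; apply/negP => kx; exact: (H k).
move: Kk; rewrite geq_max => /andP[Kk Nk].
have [j jk xj] := atom_near k x01.
exists k, j, (level k.+2), (level k.+1).+2; split => //.
- by split => //; apply: leq_trans (level_ge _); rewrite !leqW.
- by rewrite -denRV_3X.
- rewrite -[(level k.+1).+2]addn2 exprD invfM -denRV_3X.
  have := gap_lip k x (atom k j); have := denRV_step k.+1.
  have q0 : 0 < (denR k.+1)^-1 :> R by rewrite invr_gt0 denR_gt0.
  have -> : 3 ^+ 2 = 9 :> R by rewrite expr2; ring.
  lra.
have := HK k Kk; rewrite mulrDl mul1r.
have -> : ((level k.+1).+2 + level k.+2 + k.+1 =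
  level k.+2 + (level k.+1 + k.+3))%N by lia.
move=> le_e; rewrite [(_ + (_ + k.+3))%:R]natrD lerD2l; apply: le_trans le_e.
by rewrite ler_nat; have := level_ge k.+1; lia.
Qed.

Lemma local_dim_hole p k : 0 <= p <= 1 -> hole k p -> local_dim mu p = 2%:E.
Proof.
move=> p01 pk; apply/eqP; rewrite eq_le local_dim_le2//=.
exact: local_dim_hole_ge pk.
Qed.

Lemma local_dim_ge0 x : 0 <= x <= 1 -> (0%:E <= local_dim mu x)%E.
Proof.
move=> x01; apply: (@gap_measure_dim_ge _ _ 1) => //; exists 1 => // r k _.
by rewrite powRr0 mulr1 layer_le1.
Qed.

Lemma local_dim_grid x k : 0 <= x <= 1 -> grid k x -> local_dim mu x = 0%:E.
Proof.
move=> x01 xk; apply/eqP; rewrite eq_le local_dim_ge0// andbT.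
have [j jk xj] : exists2 j : nat, (j <= den k.+2)%N & x = atom k j.
  by apply: grid_atom => //; apply: grid_le xk; rewrite !leqW.
apply: gap_measure_dim_le => // e N e0.
have [b b0] : exists b : nat, 3 ^- b <= gap k (atom k j : R).
  have g0 : 0 < gap k (atom k j : R).
    by apply: gap_grid_gt0 (atom_grid k j); rewrite !leqW.
  have [b bg] := inv_den_small g0.
  by exists (level b.+2); rewrite -denRV_3X ltW// bg.
pose c := (b + level k.+2 + k.+1)%N.
exists k, j, (maxn N (Num.truncn (c%:R / e)).+1), b; split => //.
- by split => //; rewrite leq_maxl.
- by rewrite -xj subrr normr0 invr_gt0 exprn_gt0.
rewrite -/c add0r -ler_pdivrMl// mulrC; apply: (le_trans (ltW (truncnS_gt _))).
by rewrite ler_nat leq_maxr.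
Qed.

End local_dimensions.

(** * Points of prescribed local dimension at most one *)

Section nested_intervals.
Context {R : realType}.

Lemma nested_intervals_point (a b : nat -> R) :
  (forall i, a i <= a i.+1) -> (forall i, b i.+1 <= b i) ->
  (forall i, a i <= b i) -> exists x, forall i, a i <= x <= b i.
Proof.
move=> aS bS ab.
have amono : {homo a : m n / (m <= n)%N >-> m <= n}.
  by apply: homo_leq => // ? ? ?; exact: le_trans.
have bmono : {homo b : m n / (m <= n)%N >-> m >= n}.
  by apply: homo_leq => // y x z xy yz; exact: le_trans yz xy.
have ab' i j : a i <= b j.
  apply: (le_trans (amono _ _ (leq_maxl i j))).
  by apply: (le_trans (ab _)); apply: bmono; exact: leq_maxr.
have a0 : range a !=set0 by exists (a 0%N); exists 0%N.
exists (sup (range a)) => i; apply/andP; split.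
  by apply: ub_le_sup; [exists (b 0%N) => _ [j _ <-]|exists i].
by apply: ge_sup => // _ [j _ <-].
Qed.

End nested_intervals.

Section prescribed_dimension.
Context {R : realType}.
Context (h : R) (h01 : 0 < h <= 1).

Let h0 : 0 < h. Proof. by case/andP: h01. Qed.
Let h1 : h <= 1. Proof. by case/andP: h01. Qed.

(** The shift by 3 puts the approximated point within a small fraction of the
    spacing of [grid k], hence far from [hole k]. *)
Let digit_pos (k : nat) : nat := locked (Num.truncn ((level k)%:R / h)).+3.

Let digit_posE k : (level k)%:R / h <= (digit_pos k)%:R - 2 /\
  (digit_pos k)%:R - 3 <= (level k)%:R / h.
Proof.
have lh : 0 <= (level k)%:R / h by rewrite divr_ge0// ltW.
have := truncnS_gt ((level k)%:R / h).
have : (Num.truncn ((level k)%:R / h))%:R <= (level k)%:R / h by rewrite truncn_le.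
rewrite /digit_pos -lock -(addn3 (Num.truncn _)) -(addn1 (Num.truncn _)) !natrD; lra.
Qed.

Let level_digit_pos k : (level k + 3 <= digit_pos k)%N.
Proof.
rewrite /digit_pos -lock addn3 !ltnS truncn_ge_nat ?divr_ge0 ?(ltW h0)//.
by rewrite ler_pdivlMr// ler_piMr.
Qed.

(** From depth [K] on, a digit lies on the next grid. *)
Let K : nat := (Num.truncn h^-1).+1.

Let digit_pos_level k : (K <= k)%N -> (digit_pos k <= level k.+1)%N.
Proof.
move=> Kk; have hK : h^-1 < k%:R.
  by apply: lt_le_trans (truncnS_gt _) _; rewrite ler_nat.
have : (Num.truncn ((level k)%:R / h) <= level k * k)%N.
  rewrite -(ler_nat R); apply: (@le_trans _ _ ((level k)%:R / h)).
    by rewrite truncn_le divr_ge0// ltW.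
  by rewrite natrM ler_wpM2l// ltW.
rewrite /digit_pos -lock levelS mulSnr mulSnr mulSnr mulnC.
by have := level_ge k; lia.
Qed.

Let digit k : R := 3 ^- digit_pos k.

Let digit_gt0 k : 0 < digit k.
Proof. by rewrite invr_gt0 exprn_gt0. Qed.

Let digit_small k : digit k <= (denR k)^-1 / 27.
Proof.
have -> : 27 = 3 ^+ 3 :> R by rewrite !exprS expr0; ring.
rewrite denRE -invfM -exprD lef_pV2 ?posrE ?exprn_gt0//.
by rewrite ler_weXn2l ?ler1n// level_digit_pos.
Qed.

Let digit_grid k : (K <= k)%N -> grid k.+1 (digit k).
Proof.
move=> Kk; exists (3 ^ (level k.+1 - digit_pos k))%N%:Z.
rewrite -pmulrn natrX denRE /digit -[X in _ = _ / 3 ^+ X](subnK (digit_pos_level Kk)).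
by rewrite exprD invfM mulrA mulfV ?mul1r// expf_neq0.
Qed.

Let digitS k : (K <= k)%N -> digit k.+1 <= digit k / 3.
Proof.
move=> Kk; rewrite /digit -invfM lef_pV2 ?posrE ?mulr_gt0 ?exprn_gt0//.
rewrite -exprSr ler_weXn2l ?ler1n//.
by have := digit_pos_level Kk; have := level_digit_pos k.+1; lia.
Qed.

Let approx (i : nat) : R := \sum_(0 <= l < i) digit (K + l)%N.

Let approxS i : approx i.+1 = approx i + digit (K + i)%N.
Proof. by rewrite /approx big_nat_recr. Qed.

Let approx_ge0 i : 0 <= approx i.
Proof. by apply: sumr_ge0 => l _; exact/ltW. Qed.

Let approx_grid i : grid (K + i) (approx i).
Proof.
elim: i => [|i IHi]; first by rewrite /approx big_geq//; exists 0; rewrite mul0r.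
rewrite approxS addnS; apply: gridD; first exact: grid_le IHi.
by apply: digit_grid; exact: leq_addr.
Qed.

Let limit_exists : exists x, forall i,
  approx i + digit (K + i) <= x <= approx i + 3 / 2 * digit (K + i).
Proof.
have [x Hx] : exists x, forall i, approx i <= x <= approx i + 3 / 2 * digit (K + i).
  apply: nested_intervals_point => i.
  - by rewrite approxS lerDl ltW.
  - have := digitS (leq_addr i K); rewrite approxS addnS.
    have := digit_gt0 (K + i); lra.
  - by have := digit_gt0 (K + i); lra.
exists x => i; have /andP[_ ->] := Hx i; rewrite andbT -approxS.
by have /andP[] := Hx i.+1.
Qed.

Let inv_den_powR k : (denR k)^-1 <= 27 `^ h * (digit k) `^ h.
Proof.
have [_ dk] := digit_posE k.
rewrite -powRM//; last exact: ltW.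
have -> : 27 * digit k = 3 `^ (3 - (digit_pos k)%:R).
  rewrite powRB ?pnatr_eq0 ?implybT// (powR_mulrn 3)// powR_mulrn//.
  by rewrite /digit; congr (_ * _); rewrite !exprS expr0; ring.
rewrite -powRrM denRE -powR_invn// ler_powR// ?ler1n//.
rewrite lerNl; move: dk; rewrite ler_pdivlMr//; lra.
Qed.

(** The limit [x] of [approx] is at distance between [digit k] and
    [3 / 2 * digit k] from its approximation in [grid k] and no closer to any
    other point of [grid k]. A ball around [x] thus has mass of order
    [1 / den k] when its radius reaches [digit k], and the weight of the
    approximation is of that order up to a negligible exponent, because it is
    still close to the previous approximation of depth two less, a grid point at
    distance at least half a spacing from the holes. *)
Lemma local_dim_prescribed :
  exists2 x : R, 0 <= x <= 1 & local_dim (@mu_gap R) x = h%:E.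
Proof.
have [x Hx] := limit_exists.
have x01 : 0 <= x <= 1.
  have := Hx 0%N; rewrite {1 2}/approx big_geq// !add0r => /andP[xlo xhi].
  have := digit_gt0 (K + 0); have := digit_small (K + 0).
  have : (denR (K + 0))^-1 <= 1 :> R by rewrite invf_le1 ?denR_gt0// ler1n den_gt0.
  by move=> *; apply/andP; split; lra.
exists x => //.
have far i y : grid (K + i) y -> digit (K + i) <= `|x - y|.
  move=> yi; have /andP[xlo xhi] := Hx i.
  have [ya|ay] := leP y (approx i).
    by apply: le_trans (ler_norm _); lra.
  have : (denR (K + i))^-1 <= y - approx i.
    rewrite -[leRHS]gtr0_norm ?subr_gt0// leNgt; apply/negP.
    move=> /(grid_sep (gridB yi (approx_grid i))) /eqP.
    by rewrite subr_eq0 gt_eqF.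
  have := digit_small (K + i); have := digit_gt0 (K + i).
  by rewrite -normrN => *; apply: le_trans (ler_norm _); lra.
apply/eqP; rewrite eq_le; apply/andP; split; last first.
  apply: (@gap_measure_dim_ge _ _ _ (27 `^ h + 2)) => //.
  exists (Num.min 1 (digit K)); first by rewrite lt_min ltr01 digit_gt0.
  move=> r k /andP[r0]; rewrite lt_min => /andP[r1 rK].
  have rh : r <= r `^ h.
    by rewrite ger1_powR// r0 ltW.
  have rh0 : 0 <= (27 `^ h + 2) * r `^ h.
    by rewrite mulr_ge0 ?powR_ge0// addr_ge0 ?powR_ge0.
  have [kK|Kk] := ltnP k.+2 K.
    rewrite layer_ball_eq0// => j; apply: (le_trans (ltW rK)).
    rewrite -[K]addn0; apply: far; rewrite addn0.
    exact: grid_le (ltnW kK) (atom_grid k j).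
  have [i ki] : exists i, k.+2 = (K + i)%N by exists (k.+2 - K)%N; rewrite subnKC.
  have [rd|dr] := leP r (digit k.+2).
    rewrite layer_ball_eq0// => j; apply: (le_trans rd).
    by rewrite ki; apply: far; rewrite -ki; exact: atom_grid.
  have q0 : 0 < (denR k.+2)^-1 :> R by rewrite invr_gt0 denR_gt0.
  apply: (le_trans (layer_ball_le r0 (ltW q0) _)).
    move=> j _; rewrite /atom_weight ler_piMl ?(ltW q0)//.
    apply: (le_trans (gap_half k _)).
    have : (denR k)^-1 <= 1 :> R by rewrite invf_le1 ?denR_gt0// ler1n den_gt0.
    by lra.
  have -> : (denR k.+2)^-1 * (2 * (r * denR k.+2) + 1) = 2 * r + (denR k.+2)^-1.
    by field; rewrite denR_neq0.
  have : (denR k.+2)^-1 <= 27 `^ h * r `^ h.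
    apply: (le_trans (inv_den_powR _)); rewrite ler_wpM2l ?powR_ge0//.
    by rewrite ge0_ler_powR ?nnegrE ?ltW.
  by lra.
apply: gap_measure_dim_le => // e N e0.
have [L HL] := @level_growth R _ e0.
pose k := maxn L (maxn N K).
have Kk : (K <= k)%N by rewrite !leq_max leqnn !orbT.
have Nk : (N <= k)%N by rewrite !leq_max leqnn !orbT.
pose i := (k - K)%N; have kE : k = (K + i)%N by rewrite subnKC.
have kE2 : k.+2 = (K + i.+2)%N by rewrite !addnS -kE.
have /andP[xlo xhi] := Hx i.+2.
have [j jk aj] : exists2 j, (j <= den k.+2)%N & approx i.+2 = atom k j.
  apply: grid_atom; last by rewrite kE2; exact: approx_grid.
  rewrite approx_ge0/=; case/andP: x01 => _; apply: le_trans.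
  by have := digit_gt0 (K + i.+2); lra.
have [dk _] := digit_posE k.+2.
have dp0 : (0 < digit_pos k.+2)%N by have := level_digit_pos k.+2; lia.
exists k, j, (digit_pos k.+2).-1, (level k).+1; split.
- split => //; apply: (@leq_trans k) => //.
  by have := level_digit_pos k.+2; have := level_ge k.+2; lia.
- rewrite -aj; have d3 : 3 ^- (digit_pos k.+2).-1 = 3 * digit (K + i.+2).
    rewrite -kE2 /digit -[in RHS](prednK dp0) exprS invfM.
    by rewrite mulrA mulfV ?mul1r.
  rewrite d3 ger0_norm; have := digit_gt0 (K + i.+2); lra.
- rewrite exprSr invfM -denRV_3X -aj.
  have := gap_grid (leqnn k) (_ : grid k (approx i)).
  rewrite {1}kE => /(_ (approx_grid i)).
  have := gap_lip k (approx i) (approx i.+2).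
  have : approx i.+2 <= approx i + 3 / 2 * digit k.
    have /andP[_ xi] := Hx i; have := digit_gt0 (K + i.+2).
    by rewrite kE; lra.
  rewrite distrC ger0_norm; last first.
    by rewrite !approxS; have := digit_gt0 (K + i); have := digit_gt0 (K + i.+1); lra.
  have := digit_small k; have : 0 < (denR k)^-1 :> R by rewrite invr_gt0 denR_gt0.
  lra.
have LL : (L <= k)%N by rewrite leq_max leqnn.
have := HL k LL; move=> le_e.
apply: (@le_trans _ _ ((level k.+2)%:R + e * (level k.+2)%:R)).
  have -> : ((level k).+1 + level k.+2 + k.+1 = level k.+2 + (level k + k.+2))%N by lia.
  rewrite [(_ + (_ + k.+2))%:R]natrD lerD2l; apply: le_trans le_e.
  by rewrite ler_nat; have := level_ge k; have := leq_level (leqnSn k); lia.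
have : (level k.+2)%:R / h <= (digit_pos k.+2).-1%:R.
  have : (digit_pos k.+2).-1%:R + 1 = (digit_pos k.+2)%:R :> R.
    by rewrite natr1 prednK.
  lra.
set l := (level k.+2)%:R; set m := _.-1%:R => lm.
have l0 : 0 <= l by [].
have hm : l <= h * m by move: lm; rewrite ler_pdivrMr// mulrC.
have : l <= m.
  by apply: (le_trans hm); rewrite ler_piMl.
by move=> /(ler_wpM2l (ltW e0)); rewrite mulrDl; lra.
Qed.

End prescribed_dimension.

(** * Invariance under triadic translations, homogeneity *)

Section homogeneity.
Context {R : realType}.
Implicit Types (x y t : R).

Local Notation mu := (@mu_gap R).

Lemma grid_far k x : ~ grid k x ->
  exists2 d, 0 < d & forall y, grid k y -> d <= `|x - y|.
Proof.
move=> kx; pose n := Num.floor (x * denR k).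
have q0 : 0 < denR k :> R by exact: denR_gt0.
have xq z : x - z / denR k = (x * denR k - z) / denR k by field; rewrite gt_eqF.
have /andP[nx xn] := floor_itv (x * denR k); rewrite -/n intrD in nx xn.
have nx' : n%:~R < x * denR k.
  rewrite lt_neqAle nx andbT; apply/eqP => nE; apply: kx; exists n.
  by rewrite nE mulfK ?gt_eqF.
exists (Num.min (x * denR k - n%:~R) (n%:~R + 1 - x * denR k) / denR k).
  by rewrite divr_gt0// lt_min; apply/andP; split; lra.
move=> _ [z ->]; rewrite xq normrM normfV (gtr0_norm q0) ler_pM2r ?invr_gt0//.
rewrite ge_min; apply/orP; have [zn|nz] := leP z n.
  left; apply: le_trans (ler_norm _).
  by have : z%:~R <= n%:~R :> R by [rewrite ler_int]; lra.
right; rewrite -normrN; apply: le_trans (ler_norm _).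
have : (n + 1)%:~R <= z%:~R :> R by rewrite ler_int lezD1.
by rewrite intrD; lra.
Qed.

(** The bounds on the atoms of both balls say that the translation moves none of
    them across an end of the unit interval. *)
Lemma layer_translate k x t r : 0 <= t -> grid k t ->
  (forall j, `|x - atom k j| < r -> atom k j + t <= 1) ->
  (forall j, `|x + t - atom k j| < r -> t <= atom k j) ->
  layer k (ball (x + t) r) = layer k (ball x r).
Proof.
move=> t0 tk xup xlo; have q0 : 0 < denR k.+2 :> R by exact: denR_gt0.
have [s st] : exists s : nat, t = atom k s.
  have [z tz] : grid k.+2 t by apply: grid_le tk; rewrite !leqW.
  move: t0; rewrite tz pmulr_lge0 ?invr_gt0// ler0z.
  by case: z {tz} => // s _; exists s; rewrite /atom -pmulrn.
have atomD j : atom k (j + s) = atom k j + t.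
  by rewrite st /atom natrD mulrDl.
have in_ball (c y : R) : (y \in (ball c r : set R)) = (`|c - y| < r).
  by apply/idP/idP => [/set_mem//|?]; exact: mem_set.
pose F j := atom_weight k j * \1_(ball x r : set R) (atom k j) : R.
pose G j := atom_weight k j * \1_(ball (x + t) r : set R) (atom k j) : R.
have GF j : G (j + s)%N = F j.
  rewrite /G /F /atom_weight !indicE !in_ball atomD gap_periodic//.
  by congr (_ * (_ < _)%R%:R); congr `| _ |; ring.
rewrite /layer -/(G _) -/(F _); set N := (den k.+2).+1.
have G0 j : (j < s)%N -> G j = 0.
  move=> js; rewrite /G indicE in_ball; case: ltP => [/xlo|_]; last by rewrite mulr0.
  rewrite st /atom ler_pM2r ?invr_gt0// ler_nat leqNgt js//.
have F0 j : (N <= j + s)%N -> F j = 0.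
  move=> Nj; rewrite /F indicE in_ball; case: ltP => [/xup|_]; last by rewrite mulr0.
  by rewrite -atomD /atom ler_pdivrMr// mul1r ler_nat leqNgt Nj.
have [Ns|sN] := ltnP N s.
  rewrite big_nat_cond big1 => [|j /andP[/andP[_ jN] _]]; last first.
    by rewrite -/(G j) G0// (ltn_trans jN).
  rewrite big_nat_cond big1// => j _; rewrite -/(F j) F0//.
  by rewrite (leq_trans (ltnW Ns))// leq_addl.
transitivity (\sum_(0 <= j < N - s) F j).
  rewrite (big_cat_nat (n := s))//= big_nat_cond big1 ?add0r; last first.
    by move=> j /andP[/andP[_ js] _]; exact: G0.
  rewrite -{1}[s]add0n big_addn; apply: eq_bigr => j _; exact: GF.
rewrite [RHS](big_cat_nat (n := N - s))//= ?leq_subr//.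
rewrite [X in _ + X]big_nat_cond [X in _ + X]big1 ?addr0// => j /andP[/andP[Nj _] _].
by apply: F0; rewrite addnC -leq_subLR.
Qed.

(** Near a non-triadic point only the fine layers have atoms, and these are
    periodic; triadic points all have local dimension 0. *)
Lemma local_dim_translate M x t : grid M t -> 0 <= x <= 1 -> 0 <= x + t <= 1 ->
  local_dim mu (x + t) = local_dim mu x.
Proof.
wlog t0 : x t / 0 <= t.
  move=> H tM x01 xt01; have [t0|t0] := leP 0 t; first exact: H.
  rewrite -[x in RHS](addrK t); apply/esym; apply: H => //.
  - by rewrite oppr_ge0 ltW.
  - exact: gridN.
  - by rewrite addrK.
move=> tM x01 xt01.
have tM2 : grid M.+2 t by apply: grid_le tM; rewrite !leqW.
have [xM|/grid_far[d d0 xd]] := pselect (grid M.+2 x).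
  by rewrite (local_dim_grid x01 xM) (local_dim_grid xt01 (gridD xM tM2)).
apply: (@local_dim_eq _ _ _ _ d) => //; [by rewrite measure_supp_gap..|].
move=> r /andP[r0 rd]; apply: ball_mass_eq => k.
have [kM|Mk] := leqP k M.
  have atomM j : grid M.+2 (atom k j) by apply: grid_le (atom_grid k j).
  rewrite !layer_ball_eq0// => j; apply: (le_trans (ltW rd)); first exact: xd.
  have -> : x + t - atom k j = x - (atom k j - t) by ring.
  by apply: xd; exact: gridB.
have grid0 : grid M.+2 (0 : R) by exists 0; rewrite mul0r.
have grid1 : grid M.+2 (1 : R).
  by exists (den M.+2)%:Z; rewrite -pmulrn mulfV// denR_neq0.
case/andP: x01 xt01 => x0 x1 /andP[_ xt1].
have dx : d <= x by have := xd _ grid0; rewrite subr0 ger0_norm.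
have dxt : d <= 1 - t - x.
  have := xd _ (gridB grid1 tM2); rewrite distrC ger0_norm//; lra.
apply: layer_translate => //; first exact: grid_le (ltnW Mk) tM.
  move=> j; rewrite ltr_norml => /andP[]; lra.
move=> j; rewrite ltr_norml => /andP[]; lra.
Qed.

Lemma triadic_subinterval (a b : R) : 0 <= a -> a < b -> exists M i : nat,
  a <= i%:R / denR M /\ (i%:R + 1) / denR M <= b.
Proof.
move=> a0 ab; have ab2 : 0 < (b - a) / 2 by rewrite divr_gt0 ?subr_gt0.
have [K /(_ _ (leqnn _)) Kq] := inv_den_small ab2.
have q0 : 0 < denR K.+2 :> R by exact: denR_gt0.
exists K.+2, (Num.truncn (a * denR K.+2)).+1.
have aq : 0 <= a * denR K.+2 by rewrite mulr_ge0// ltW.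
have ta : (Num.truncn (a * denR K.+2))%:R <= a * denR K.+2 by rewrite truncn_le.
split; first by rewrite ler_pdivlMr// ltW// truncnS_gt.
rewrite ler_pdivrMr// -natr1.
have : 2 < (b - a) * denR K.+2.
  move: Kq; rewrite -div1r ltr_pdivrMr//; lra.
lra.
Qed.

Lemma homogeneous_gap_measure : homogeneously_multifractal mu.
Proof.
move=> U U01 Uitv [a [b [Ua Ub ab]]] h h0; apply/eqP; rewrite eq_le.
apply/andP; split; first by apply: hausdorff_dim_subset => x [/U01].
have /andP[a0 _] : 0 <= a <= 1 by have := U01 _ Ua; rewrite /= in_itv.
have /andP[_ b1] : 0 <= b <= 1 by have := U01 _ Ub; rewrite /= in_itv.
have [M [i [ai ib]]] := triadic_subinterval a0 ab.
have q0 : 0 < denR M :> R by exact: denR_gt0.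
pose t (j : nat) : R := j%:R / denR M - i%:R / denR M.
apply: (@hausdorff_dim_translates _ _ _ t (den M).+1) => y [].
rewrite /= in_itv/= => /andP[y0 y1] yh.
pose j := Num.truncn (y * denR M).
have yq0 : 0 <= y * denR M by rewrite mulr_ge0// ltW.
have jy : j%:R / denR M <= y by rewrite ler_pdivrMr// truncn_le.
have yj : y < (j%:R + 1) / denR M by rewrite ltr_pdivlMr// natr1 truncnS_gt.
exists j.
  rewrite /= ltnS -(ler_nat R) -/(denR M); move: jy; rewrite ler_pdivrMr// => /le_trans.
  by apply; rewrite ler_piMl// ltW.
have atj : a <= y - t j by rewrite /t; lra.
have tjb : y - t j <= b.
  by rewrite /t; move: ib yj; rewrite !mulrDl; lra.
have tM : grid M (t j) by apply: gridB; exact: grid_nat.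
exists (y - t j); last by rewrite subrK.
split; first by apply: (Uitv a b) => //; rewrite atj.
rewrite /local_dim_level /= -yh; apply: (@local_dim_translate M).
- exact: gridN.
- by rewrite y0.
- by rewrite (le_trans a0)//= (le_trans tjb).
Qed.

End homogeneity.

Theorem proposition1p6 (R : realType) :
  exists mu : {finite_measure set (measurableTypeR R) -> \bar R},
    [/\ measure_supp mu `<=` `[0, 1],
        homogeneously_multifractal mu &
        spectrum_support mu = `[0, 1] `|` [set 2]].
Proof.
exists mu_gap; split.
- by move=> x; rewrite measure_supp_gap /= in_itv.
- exact: homogeneous_gap_measure.
apply/seteqP; split => h.
  case=> h0 /hausdorff_dim_ge0[x [+ xh]]; rewrite /= in_itv/= => x01.
  rewrite /local_dim_level /= in xh.
  have [[k xk]|xk] := pselect (exists k, hole k x).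
    by right; move: xh; rewrite (local_dim_hole x01 xk) => -[].
  left; rewrite /= in_itv/= h0/= -lee_fin -xh.
  exact: local_dim_not_hole_le.
have attained x : 0 <= x <= 1 -> local_dim mu_gap x = h%:E -> 0 <= h ->
    spectrum_support mu_gap h.
  move=> x01 xh h0; split => //; apply/hausdorff_dim_ge0; exists x.
  by split; [rewrite /= in_itv|exact: xh].
case=> [|/= h_eq2].
  rewrite /= in_itv/= => /andP[]; rewrite le_eqVlt => /predU1P[h_eq0 _|h0 h1].
    have zero01 : 0 <= (0 : R) <= 1 by rewrite lexx ler01.
    apply: (attained _ zero01); rewrite -h_eq0//; apply: (@local_dim_grid _ _ 0) => //.
    by exists 0; rewrite mul0r.
  have [|x x01 xh] := @local_dim_prescribed _ h; first by rewrite h0.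
  exact: attained xh (ltW h0).
pose p : R := 2^-1 / denR 0.
have p01 : 0 <= p <= 1.
  have q1 : 1 <= denR 0 :> R by rewrite ler1n den_gt0.
  apply/andP; split; first by rewrite divr_ge0// ltW// denR_gt0.
  by rewrite ler_pdivrMr ?denR_gt0//; lra.
apply: (attained _ p01); rewrite h_eq2//; apply: (@local_dim_hole _ _ 0) => //.
by exists 0; rewrite add0r.
Qed.
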